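(* Let $\mathcal{I}=\left((\mathrm{E}_\alpha)_{\alpha\in I},(p_{\beta,\alpha})_{\beta\succcurlyeq\alpha}\right)$ be an inverse system in $\mathbf{VL}$ and $\mathcal{S}=\left(\mathrm{E},(p_\alpha)_{\alpha\in I}\right)$ its inverse limit in $\mathbf{VL}$. The following statements are true. (i) If $\mathrm{E}_\alpha$ is Archimedean for every $\alpha\in I$, then so is $\mathrm{E}$. (ii) If $\mathrm{E}_\alpha$ is Archimedean and relatively uniformly complete for every $\alpha\in I$, then $\mathrm{E}$ is relatively uniformly complete.
   Context: All vector lattices are real. $\mathbf{VL}$ is the category of vector lattices and (linear) lattice homomorphisms. An inverse system in $\mathbf{VL}$ consists of a directed set $I$, vector lattices $\mathrm{E}_\alpha$ and lattice homomorphisms $p_{\beta,\alpha}:\mathrm{E}_\beta\to\mathrm{E}_\alpha$ ($\beta\succcurlyeq\alpha$) with $p_{\beta,\alpha}\circ p_{\gamma,\beta}=p_{\gamma,\alpha}$ for $\alpha\preccurlyeq\beta\preccurlyeq\gamma$. Its inverse limit in $\mathbf{VL}$ is (up to unique isomorphism) $\mathrm{E}=\{(u_\alpha)\in\prod\mathrm{E}_\alpha : u_\alpha=p_{\beta,\alpha}(u_\beta) \text{ for all } \alpha\preccurlyeq\beta\}$ with coordinatewise operations and $p_\alpha:\mathrm{E}\to\mathrm{E}_\alpha$ the restricted coordinate projections. A sequence $(u_n)$ in a vector lattice is relatively uniformly Cauchy if there is $w\ge 0$ such that for every $\epsilon>0$ there is $N$ with $|u_n-u_m|\le\epsilon w$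 for all $n,m\ge N$; it converges relatively uniformly to $u$ if there is $w\ge0$ such that for every $\epsilon>0$, $|u_n-u|\le\epsilon w$ for all sufficiently large $n$. A vector lattice is relatively uniformly complete if every relatively uniformly Cauchy sequence converges relatively uniformly. *)

(* Defs.v *)
From HB Require Import structures.
From mathcomp Require Import all_boot all_order all_algebra.
From mathcomp Require Import boolp classical_sets reals.

Set Implicit Arguments.
Unset Strict Implicit.
Unset Printing Implicit Defensive.

Import Order.TTheory GRing.Theory Num.Theory.

Local Open Scope ring_scope.

(* Order.Lattice cannot be joined with GRing.Lmodule: Hierarchy Builder rejects
   the join, because Num.RealDomain already inherits from both Order.Lattice
   and the additive structures.  So the order is the library one
   (Num.POrderedZmodule), and the two lattice operations are fields with the
   characteristic properties of Order.POrder_MeetJoin_isLattice. *)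
HB.mixin Record isVectorLattice (R : realType) E
    of GRing.Lmodule R E & Num.POrderedZmodule E := {
  vmeet : E -> E -> E;
  vjoin : E -> E -> E;
  vmeetP : forall u v w : E, (u <= vmeet v w) = (u <= v) && (u <= w);
  vjoinP : forall u v w : E, (vjoin u v <= w) = (u <= w) && (v <= w);
  vl_leD2r : forall u v w : E, u <= v -> u + w <= v + w;
  vl_scaler_ge0 : forall (a : R) (u : E), 0 <= a -> 0 <= u -> 0 <= a *: u
}.

#[short(type="vectorLatticeType")]
HB.structure Definition VectorLattice (R : realType) :=
  { E of isVectorLattice R E & GRing.Lmodule R E & Num.POrderedZmodule E }.

HB.mixin Record isLatticeHom (R : realType) (E F : vectorLatticeType R)
    (f : E -> F) := {
  vlhomI : {morph f : u v / vmeet u v};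
  vlhomU : {morph f : u v / vjoin u v}
}.

#[short(type="vlHomType")]
HB.structure Definition VLHom (R : realType) (E F : vectorLatticeType R) :=
  { f of isLatticeHom R E F f & @GRing.Linear R E F *:%R f }.

Notation "{ 'vlhom' E -> F }" := (vlHomType E%type F%type)
  (at level 0, E at level 98, F at level 99,
   format "{ 'vlhom'  E  ->  F }") : type_scope.

Section VectorLatticeNotions.
Context (R : realType) (E : vectorLatticeType R).

(* The modulus |u|; `|u| would be the norm of a normed module. *)
Definition vabs (u : E) : E := vjoin u (- u).

Definition archimedean : Prop := forall u : E, 0 <= u ->
  infimums (range (fun n : nat => n.+1%:R^-1 *: u)) 0.

Definition ru_cauchy (u : nat -> E) : Prop :=
  exists w : E, 0 <= w /\ forall eps : R, 0 < eps ->
    exists N : nat, forall n m : nat, (N <= n)%N -> (N <= m)%N ->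
      vabs (u n - u m) <= eps *: w.

Definition ru_converges (u : nat -> E) (l : E) : Prop :=
  exists w : E, 0 <= w /\ forall eps : R, 0 < eps ->
    exists N : nat, forall n : nat, (N <= n)%N ->
      vabs (u n - l) <= eps *: w.

Definition ru_complete : Prop :=
  forall u : nat -> E, ru_cauchy u -> exists l : E, ru_converges u l.

End VectorLatticeNotions.

Arguments archimedean {R} E.
Arguments ru_complete {R} E.

Definition directed d (I : preorderType d) : Prop :=
  inhabited I /\ forall a b : I, exists c : I, (a <= c)%O /\ (b <= c)%O.

(* bond (h : a <= b) is the map p_{b,a} : E_b -> E_a.  The requirement
   p_{a,a} = id is not part of the definition; composition only makes p_{a,a}
   idempotent. *)
Record inverse_system (R : realType) d (I : preorderType d) := InverseSystem {
  obj :> I -> vectorLatticeType R;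
  bond : forall a b : I, (a <= b)%O -> {vlhom obj b -> obj a};
  index_directed : directed I;
  bond_comp : forall (a b c : I) (ab : (a <= b)%O) (bc : (b <= c)%O)
    (ac : (a <= c)%O) (u : obj c), bond ab (bond bc u) = bond ac u
}.

Arguments bond {R d I} S {a b} ab : rename.

Section InverseLimit.
Context (R : realType) d (I : preorderType d) (S : inverse_system R I).

Definition compatible (E : vectorLatticeType R)
    (p : forall a : I, {vlhom E -> S a}) : Prop :=
  forall (a b : I) (ab : (a <= b)%O) (u : E), p a u = bond S ab (p b u).

Definition is_inverse_limit (E : vectorLatticeType R)
    (p : forall a : I, {vlhom E -> S a}) : Prop :=
  compatible p /\
  forall (F : vectorLatticeType R) (q : forall a : I, {vlhom F -> S a}),
    compatible q ->
    exists r : {vlhom F -> E},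
      (forall a u, p a (r u) = q a u) /\
      (forall r' : {vlhom F -> E},
         (forall a u, p a (r' u) = q a u) -> r' =1 r).

(* Existence: the compatible families with coordinatewise operations form an
   inverse limit, so any (E, p) satisfying is_inverse_limit is, up to a unique
   isomorphism, this one. *)
Record thread := Thread {
  thread_val :> forall a : I, S a;
  threadP : forall (a b : I) (ab : (a <= b)%O),
    thread_val a = bond S ab (thread_val b)
}.

Lemma thread_eq (u v : thread) : (forall a, u a = v a) -> u = v.
Proof.
case: u v => [u uP] [v vP] /= uv.
have {}uv : u = v by apply: functional_extensionality_dep.
by subst v; congr Thread; apply: Prop_irrelevance.
Qed.

HB.instance Definition _ := gen_eqMixin thread.
HB.instance Definition _ := gen_choiceMixin thread.

#[local] Obligation Tactic := idtac.

Program Definition thread0 := @Thread (fun a => 0) _.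
Next Obligation. by move=> a b ab; rewrite linear0. Qed.
Program Definition threadN (u : thread) := @Thread (fun a => - u a) _.
Next Obligation. by move=> u a b ab; rewrite linearN /= -(threadP u ab). Qed.
Program Definition threadD (u v : thread) := @Thread (fun a => u a + v a) _.
Next Obligation. by move=> u v a b ab; rewrite linearD /= -(threadP u ab) -(threadP v ab). Qed.
Program Definition threadZ (k : R) (u : thread) :=
  @Thread (fun a => k *: u a) _.
Next Obligation. by move=> k u a b ab; rewrite linearZ /= -(threadP u ab). Qed.
Program Definition threadI (u v : thread) :=
  @Thread (fun a => vmeet (u a) (v a)) _.
Next Obligation. by move=> u v a b ab; rewrite vlhomI /= -(threadP u ab) -(threadP v ab). Qed.
Program Definition threadU (u v : thread) :=
  @Thread (fun a => vjoin (u a) (v a)) _.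
Next Obligation. by move=> u v a b ab; rewrite vlhomU /= -(threadP u ab) -(threadP v ab). Qed.
Definition thread_le (u v : thread) : bool := `[< forall a, u a <= v a >].

Fact threadDA : associative threadD.
Proof. by move=> u v w; apply: thread_eq => a; apply: addrA. Qed.
Fact threadDC : commutative threadD.
Proof. by move=> u v; apply: thread_eq => a; apply: addrC. Qed.
Fact thread0D : left_id thread0 threadD.
Proof. by move=> u; apply: thread_eq => a; apply: add0r. Qed.
Fact threadND : left_inverse thread0 threadN threadD.
Proof. by move=> u; apply: thread_eq => a; apply: addNr. Qed.

HB.instance Definition _ :=
  GRing.isZmodule.Build thread threadDA threadDC thread0D threadND.

Fact threadZA (k l : R) (u : thread) :
  threadZ k (threadZ l u) = threadZ (k * l) u.
Proof. by apply: thread_eq => a; apply: scalerA. Qed.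
Fact threadZ1 : left_id 1 threadZ.
Proof. by move=> u; apply: thread_eq => a; apply: scale1r. Qed.
Fact threadZDr : right_distributive threadZ +%R.
Proof. by move=> k u v; apply: thread_eq => a; apply: scalerDr. Qed.
Fact threadZDl (u : thread) : {morph threadZ^~ u : k l / k + l}.
Proof. by move=> k l; apply: thread_eq => a; apply: scalerDl. Qed.

HB.instance Definition _ :=
  GRing.Zmodule_isLmodule.Build R thread threadZA threadZ1 threadZDr threadZDl.

Fact thread_le_refl : reflexive thread_le.
Proof. by move=> u; apply/asboolP. Qed.
Fact thread_le_anti : antisymmetric thread_le.
Proof.
move=> u v /andP[/asboolP uv /asboolP vu].
by apply: thread_eq => a; apply: le_anti; rewrite uv vu.
Qed.
Fact thread_le_trans : transitive thread_le.
Proof.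
move=> v u w /asboolP uv /asboolP vw.
by apply/asboolP => a; apply: le_trans (vw a).
Qed.

HB.instance Definition _ := Order.Le_isPOrder.Build ring_display thread
  thread_le_refl thread_le_anti thread_le_trans.

Fact threadIP (u v w : thread) : (u <= threadI v w) = (u <= v) && (u <= w).
Proof.
apply/asboolP/andP => [h|[/asboolP uv /asboolP uw] a].
  by split; apply/asboolP => a; have := h a; rewrite /= vmeetP => /andP[].
by rewrite /= vmeetP uv uw.
Qed.
Fact threadUP (u v w : thread) : (threadU u v <= w) = (u <= w) && (v <= w).
Proof.
apply/asboolP/andP => [h|[/asboolP uw /asboolP vw] a].
  by split; apply/asboolP => a; have := h a; rewrite /= vjoinP => /andP[].
by rewrite /= vjoinP uw vw.
Qed.

Fact thread_leD2r (u v w : thread) : u <= v -> u + w <= v + w.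
Proof.
move=> /asboolP uv; apply/asboolP => a.
exact: (vl_leD2r (u a) (v a) (w a) (uv a)).
Qed.
Fact thread_scaler_ge0 (k : R) (u : thread) : 0 <= k -> 0 <= u -> 0 <= k *: u.
Proof.
move=> k0 /asboolP u0; apply/asboolP => a.
exact: (vl_scaler_ge0 k (u a) k0 (u0 a)).
Qed.

HB.instance Definition _ :=
  isVectorLattice.Build R thread threadIP threadUP
  thread_leD2r thread_scaler_ge0.

Definition thread_proj (a : I) (u : thread) : S a := u a.

Fact thread_proj_linear a : linear (thread_proj a).
Proof. by []. Qed.
HB.instance Definition _ a := GRing.isLinear.Build R thread (S a) *:%R
  (thread_proj a) (thread_proj_linear a).
Fact thread_projI a : {morph thread_proj a : u v / vmeet u v}.
Proof. by []. Qed.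
Fact thread_projU a : {morph thread_proj a : u v / vjoin u v}.
Proof. by []. Qed.
HB.instance Definition _ a := isLatticeHom.Build R thread (S a)
  (thread_proj a) (@thread_projI a) (@thread_projU a).

Section Factor.
Context (F : vectorLatticeType R) (q : forall a : I, {vlhom F -> S a})
  (qP : compatible q).

Definition thread_lift (u : F) : thread :=
  @Thread (fun a => q a u) (fun a b ab => qP ab u).

Fact thread_lift_linear : linear thread_lift.
Proof. by move=> k u v; apply: thread_eq => a /=; rewrite linearP. Qed.
HB.instance Definition _ := GRing.isLinear.Build R F thread *:%R
  thread_lift thread_lift_linear.
Fact thread_liftI : {morph thread_lift : u v / vmeet u v}.
Proof. by move=> u v; apply: thread_eq => a /=; rewrite vlhomI. Qed.
Fact thread_liftU : {morph thread_lift : u v / vjoin u v}.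
Proof. by move=> u v; apply: thread_eq => a /=; rewrite vlhomU. Qed.
HB.instance Definition _ := isLatticeHom.Build R F thread
  thread_lift thread_liftI thread_liftU.

End Factor.

Lemma thread_is_inverse_limit :
  @is_inverse_limit thread (fun a => thread_proj a : {vlhom thread -> S a}).
Proof.
split=> [a b ab u|F q qP]; first exact: threadP.
exists (thread_lift qP : {vlhom F -> thread}); split=> // r' r'q u.
by apply: thread_eq => a; apply: r'q.
Qed.

End InverseLimit.

(* Main.v *)
(** The universal property identifies [E] with the lattice of threads, so the
    projections jointly reflect the order and every thread is realised in [E].
    The order reflection gives (i).  For (ii), a sequence that is relatively
    uniformly Cauchy with regulator [w] has a limit in each coordinate, and in
    an Archimedean lattice this limit is unique and is approached with regulator
    [p a w], at the same rate as the Cauchy condition.  Uniqueness makes the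
    coordinate limits a thread, and the common rate makes the corresponding
    element of [E] the limit with regulator [w]. *)
Require Import Defs.
From HB Require Import structures.
From mathcomp Require Import all_boot all_order all_algebra.
From mathcomp Require Import boolp classical_sets reals.

Set Implicit Arguments.
Unset Strict Implicit.
Unset Printing Implicit Defensive.

Import Order.TTheory GRing.Theory Num.Theory.

Local Open Scope ring_scope.

Section VectorLatticeTheory.
Context (R : realType) (E : vectorLatticeType R).
Implicit Types (u v w x y z s t : E).

Lemma vl_leD u v x y : u <= v -> x <= y -> u + x <= v + y.
Proof.
move=> uv xy; apply: le_trans (vl_leD2r _ _ x uv) _.
by rewrite ![v + _]addrC; apply: vl_leD2r.
Qed.

Lemma vl_subr_ge0 u v : (0 <= v - u) = (u <= v).
Proof.
apply/idP/idP => [/(vl_leD2r _ _ u)|/(vl_leD2r _ _ (- u))].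
  by rewrite add0r subrK.
by rewrite subrr.
Qed.

(** Turns order into an equation, which lattice homomorphisms preserve and jointly injective
    families of them reflect. *)
Lemma vmeet_eql u v : vmeet u v = u <-> u <= v.
Proof.
have /andP[Iu Iv] : (vmeet u v <= u) && (vmeet u v <= v) by rewrite -vmeetP.
by split=> [<- //|uv]; apply: le_anti; rewrite vmeetP lexx Iu uv.
Qed.

Lemma vabs_le u v : (vabs u <= v) = (u <= v) && (- u <= v).
Proof. exact: vjoinP. Qed.

Lemma vabs_distC u v : vabs (u - v) = vabs (v - u).
Proof.
have le_swap x y : vabs (x - y) <= vabs (y - x).
  by rewrite vabs_le opprB andbC -(opprB y x) -vabs_le.
by apply: le_anti; rewrite !le_swap.
Qed.

Lemma vabs_sub_trans y x z s t :
  vabs (x - y) <= s -> vabs (y - z) <= t -> vabs (x - z) <= s + t.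
Proof.
rewrite !vabs_le !opprB => /andP[xy yx] /andP[yz zy].
rewrite -(subrKA y x (- z)) (vl_leD xy yz) /=.
by rewrite -(subrKA y z (- x)) [s + t]addrC (vl_leD zy yx).
Qed.

Lemma archimedean_le x y v : archimedean E -> 0 <= v ->
  (forall eps : R, 0 < eps -> x <= y + eps *: v) -> x <= y.
Proof.
(* The goal becomes [x - y <= 0]: [x - y] is a lower bound of all [n.+1%:R^-1 *: v], whose infimum
   is 0. *)
move=> archE v0 xy; rewrite -vl_subr_ge0 -opprB -sub0r vl_subr_ge0.
have [_ glb] := archE v v0; apply: glb => _ [n _ <-].
have := vl_leD2r _ _ (- y) (xy n.+1%:R^-1 _).
by rewrite [y + _]addrC addrK; apply; rewrite invr_gt0 ltr0n.
Qed.

Lemma archimedean_sub_eq x y v : archimedean E -> 0 <= v ->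
  (forall eps : R, 0 < eps -> vabs (x - y) <= eps *: v) -> x = y.
Proof.
move=> archE v0 xy.
have sub_le (eps : R) : 0 < eps -> (x - y <= eps *: v) && (y - x <= eps *: v).
  by move=> /xy; rewrite vabs_le opprB.
apply: le_anti; apply/andP; split; apply: (archimedean_le archE v0) => eps /sub_le.
  by move=> /andP[/(vl_leD2r _ _ y)]; rewrite subrK addrC.
by move=> /andP[_ /(vl_leD2r _ _ x)]; rewrite subrK addrC.
Qed.

Lemma archimedean_ru_converges_le (u : nat -> E) (l w : E) (N : nat) :
  archimedean E -> ru_converges u l ->
  (forall n m, (N <= n)%N -> (N <= m)%N -> vabs (u n - u m) <= w) ->
  forall n, (N <= n)%N -> vabs (u n - l) <= w.
Proof.
move=> archE [v [v0 uv]] uN n Nn; apply: (archimedean_le archE v0) => eps e0.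
have [M uM] := uv _ e0.
(* A term past both [N] and [M] is within [w] of [u n] and within [eps *: v] of [l]. *)
by apply: (@vabs_sub_trans (u (maxn N M))); [apply: uN|apply: uM];
  rewrite ?leq_maxl ?leq_maxr.
Qed.

End VectorLatticeTheory.

Section VLHomTheory.
Context (R : realType) (E F : vectorLatticeType R) (f : {vlhom E -> F}).

Lemma vlhom_abs u : f (vabs u) = vabs (f u).
Proof. by rewrite /vabs vlhomU linearN. Qed.

Lemma vlhom_le u v : u <= v -> f u <= f v.
Proof.
by move=> /vmeet_eql uv; apply/vmeet_eql; rewrite -vlhomI uv.
Qed.

Lemma vlhom_ge0 u : 0 <= u -> 0 <= f u.
Proof. by move=> /vlhom_le; rewrite linear0. Qed.

Lemma vlhom_abs_sub_le (u v w : E) (eps : R) :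
  vabs (u - v) <= eps *: w -> vabs (f u - f v) <= eps *: f w.
Proof. by move=> /vlhom_le; rewrite vlhom_abs linearB linearZ. Qed.

End VLHomTheory.

Section VLHomCategory.
Context (R : realType) (E F G : vectorLatticeType R).
Context (g : {vlhom F -> G}) (f : {vlhom E -> F}).

(** The uniqueness clause of the universal property speaks of bundled homomorphisms, so identities
    and composites must carry this structure. *)
Fact idfun_vlhomI : {morph @idfun E : u v / vmeet u v}. Proof. by []. Qed.
Fact idfun_vlhomU : {morph @idfun E : u v / vjoin u v}. Proof. by []. Qed.
HB.instance Definition _ :=
  isLatticeHom.Build R E E idfun idfun_vlhomI idfun_vlhomU.

Fact comp_vlhomI : {morph g \o f : u v / vmeet u v}.
Proof. by move=> u v /=; rewrite !vlhomI. Qed.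
Fact comp_vlhomU : {morph g \o f : u v / vjoin u v}.
Proof. by move=> u v /=; rewrite !vlhomU. Qed.
HB.instance Definition _ :=
  isLatticeHom.Build R E G (g \o f) comp_vlhomI comp_vlhomU.

End VLHomCategory.

Section InverseLimitTheory.
Context (R : realType) (d : Order.disp_t) (I : preorderType d).
Context (S : inverse_system R I) (E : vectorLatticeType R).
Context (p : forall a : I, {vlhom E -> S a}) (hE : is_inverse_limit p).

(** With [g] the factorization of the thread projections through [E], both [g \o thread_lift pP] and
    the identity factor [p] through itself. They agree by uniqueness, so [thread_lift pP] is
    injective. *)
Lemma inverse_limit_inj u v : (forall a, p a u = p a v) -> u = v.
Proof.
case: hE => pP univ uv.
have [r [_ r_uniq]] := univ E p pP.
have [g [pg _]] := univ _ _ (thread_is_inverse_limit S).1.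
have gK w : g (thread_lift pP w) = w.
  have /= -> := r_uniq (g \o thread_lift pP : {vlhom E -> E}) _ w.
    by have /= <- := r_uniq (idfun : {vlhom E -> E}) _ w.
  by move=> a x /=; rewrite pg.
rewrite -(gK u) -(gK v); congr (g _).
by apply: thread_eq => a; apply: uv.
Qed.

Lemma inverse_limit_le u v : (forall a, p a u <= p a v) -> u <= v.
Proof.
move=> uv; apply/vmeet_eql/inverse_limit_inj => a.
by rewrite vlhomI; apply/vmeet_eql.
Qed.

Lemma inverse_limit_thread (t : thread S) : exists u, forall a, p a u = t a.
Proof.
have [g [pg _]] := hE.2 _ _ (thread_is_inverse_limit S).1.
by exists (g t) => a; rewrite pg.
Qed.

Lemma inverse_limit_archimedean :
  (forall a, archimedean (S a)) -> archimedean E.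
Proof.
move=> archS u u0; split.
  by move=> _ [n _ <-]; apply: vl_scaler_ge0; rewrite ?invr_ge0.
move=> v vP; apply: inverse_limit_le => a; rewrite linear0.
(* A lower bound in [E] projects to a lower bound of the multiples of [p a u]. *)
have [_ glb] := archS a _ (vlhom_ge0 (p a) u0); apply: glb => _ [n _ <-].
by rewrite -linearZ; apply: vlhom_le; apply: vP; exists n.
Qed.

Lemma inverse_limit_ru_complete :
  (forall a, archimedean (S a) /\ ru_complete (S a)) -> ru_complete E.
Proof.
move=> hS u [w [w0 uw]].
have cvg_p a : exists l : S a, ru_converges (fun n => p a (u n)) l.
  apply: (hS a).2; exists (p a w); split; first exact: vlhom_ge0.
  move=> eps /uw [N uN]; exists N => n m Nn Nm.
  by apply: vlhom_abs_sub_le; apply: uN.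
pose l a := projT1 (cid (cvg_p a)).
(* [N] is chosen before [a]: it comes from the Cauchy condition in [E], not from the convergence in
   each coordinate. *)
have rate (eps : R) : 0 < eps -> exists N : nat, forall a n, (N <= n)%N ->
    vabs (p a (u n) - l a) <= eps *: p a w.
  move=> /uw [N uN]; exists N => a.
  apply: (archimedean_ru_converges_le (hS a).1 (projT2 (cid (cvg_p a)))) => n m Nn Nm.
  by apply: vlhom_abs_sub_le; apply: uN.
have lT (a b : I) (ab : (a <= b)%O) : l a = bond S ab (l b).
  apply: (archimedean_sub_eq (hS a).1 (vlhom_ge0 (p a) w0)) => eps e0.
  (* Half of [eps] for each side of [p a (u N)]. The second half is the estimate at [b] pushed
     through the bond, which sends [p b w] to [p a w]. *)
  have [N lN] := rate _ (divr_gt0 e0 (ltr0n R 2)).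
  rewrite (splitr eps) scalerDl; apply: (@vabs_sub_trans _ _ (p a (u N))).
    by rewrite vabs_distC; apply: lN.
  by rewrite !(hE.1 a b ab); apply: vlhom_abs_sub_le; apply: lN.
have [v vP] := inverse_limit_thread (Thread lT).
exists v, w; split=> // eps /rate [N lN]; exists N => n Nn.
apply: inverse_limit_le => a.
by rewrite vlhom_abs linearB linearZ /= vP; apply: lN.
Qed.

End InverseLimitTheory.

Theorem theorem4p7 (R : realType) (d : Order.disp_t) (I : preorderType d)
    (S : inverse_system R I) (E : vectorLatticeType R)
    (p : forall a : I, {vlhom E -> S a}) (hE : is_inverse_limit p) :
  ((forall a : I, archimedean (S a)) -> archimedean E) /\
  ((forall a : I, archimedean (S a) /\ ru_complete (S a)) -> ru_complete E).
Proof.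
by split; [exact: inverse_limit_archimedean hE|exact: inverse_limit_ru_complete hE].
Qed.
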